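(* Let $N$ be a prime, let $\alpha\in(0,1)$ and $K\geq1$ be real numbers, let $k\geq 2$ be an integer, and let $A\subseteq\mathbb{Z}/N\mathbb{Z}$ be a set with $|A|=\alpha N$ and $|A+A|=K|A|$. If $\alpha\leq(16kK)^{-12K^2}$, then $A$ is rectifiable of order $k$.
   Context: $A+A=\{a+a':a,a'\in A\}$. If $A,B$ are subsets of abelian groups and $f:A\to B$ is injective, $f$ is a Freiman isomorphism of order $k$ ($F_k$-isomorphism) if for all $a_1,\dots,a_k,a_1',\dots,a_k'\in A$ the equation $a_1+\dots+a_k=a_1'+\dots+a_k'$ holds if and only if $f(a_1)+\dots+f(a_k)=f(a_1')+\dots+f(a_k')$. A set of residues is rectifiable of order $k$ if it is $F_k$-isomorphic to a set of integers. *)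

(* Defs.v *)
From mathcomp Require Import all_boot all_algebra.
From mathcomp Require Import all_classical.

Set Implicit Arguments.
Unset Strict Implicit.
Unset Printing Implicit Defensive.

Import GRing.Theory.
Local Open Scope ring_scope.

Definition sumset (G : finZmodType) (A B : {set G}) : {set G} :=
  [set a + b | a in A, b in B]%SET.

(* The map A -> B is encoded by a total function f : G -> H whose values off A
   are irrelevant. Surjectivity onto B is not required; since B can always be
   shrunk to the image of A, this does not affect rectifiability. *)
Definition freiman_iso (k : nat) (G H : zmodType) (A : set G) (B : set H)
    (f : G -> H) : Prop :=
  [/\ set_fun A B f,
      set_inj A f
    & forall a a' : 'I_k -> G,
        (forall i, A (a i)) -> (forall i, A (a' i)) ->
        (\sum_(i < k) a i = \sum_(i < k) a' i
         <-> \sum_(i < k) f (a i) = \sum_(i < k) f (a' i))].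

Definition rectifiable (k : nat) (G : zmodType) (A : set G) : Prop :=
  exists (B : set int) (f : G -> int), freiman_iso k A B f.

(* Main.v *)
Require Import Defs.
From mathcomp Require Import all_classical all_reals all_analysis.
From mathcomp Require Import all_boot all_order all_algebra.
From mathcomp Require Import trigo zify ring lra.

(** By Petridis' argument some non-empty [Y] in [A] satisfies
    [|Y + A + A| <= K^2 |Y|], and a maximality argument then gives a set [X] of
    at most [2 K^2 - 1] elements such that every translate [t + Y], with [t] in
    [A + A], has more than half of its elements in [X + Y]. Hence
    [A + n (X + Y)] lies in a translate of [2n X - n X + (A - A)] and grows only
    polynomially in [n]. If for every non-zero frequency [r] the product of the
    Fourier coefficients of [X] and [Y] at [r] were bounded away from its trivial
    bound, the convolution of [A] with [n] copies of [X] and [Y] would be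
    equidistributed, contradicting the smallness of [A]. So at some [r] all of
    [X] and most of [Y] concentrate on a short arc, and by the covering property
    so does [r A]: it lies in an arc of length less than [N / k], on which
    lifting to the integers is a Freiman isomorphism of order [k]. *)

Set Implicit Arguments.
Unset Strict Implicit.

Import Order.TTheory GRing.Theory Num.Theory.
Local Open Scope ring_scope.

(** * Sumset inequalities of Petridis and Ruzsa *)

Section Sumsets.
Variable G : finZmodType.
Implicit Types A B C X Y Z : {set G}.

Lemma mem_sumset A B a b : a \in A -> b \in B -> a + b \in sumset A B.
Proof. exact: imset2_f. Qed.

Lemma sumsetP A B x :
  reflect (exists a b, [/\ a \in A, b \in B & x = a + b]) (x \in sumset A B).
Proof.
apply: (iffP imset2P) => [[a b aA bB ->]|[a [b [aA bB ->]]]]; first by exists a, b.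
by exists a b.
Qed.

Lemma sumsetS A A' B B' :
  A \subset A' -> B \subset B' -> sumset A B \subset sumset A' B'.
Proof. exact: imset2S. Qed.

Lemma card_sumset1 A c : #|sumset A [set c]| = #|A|.
Proof.
rewrite /sumset imset2_set1r card_imset //.
exact: addIr.
Qed.

(** Minimality of the expansion ratio, cross-multiplied to stay in [nat] and to admit the empty
    [Z]. *)
Definition min_expanding A Y :=
  forall Z, Z \subset A -> (#|sumset Y A| * #|Z| <= #|sumset Z A| * #|Y|)%N.

Lemma exists_min_expanding A : A != set0 ->
  exists Y, [/\ Y \subset A, Y != set0 & min_expanding A Y].
Proof.
move=> A0.
pose P (Z : {set G}) := (Z \subset A) && (Z != set0).
pose F (Z : {set G}) : rat := #|sumset Z A|%:R / #|Z|%:R.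
have PA : P A by rewrite /P subxx.
case: (arg_minP F PA) => Y /andP[YA Y0] Ymin.
exists Y; split=> // Z ZA.
have [->|Z0] := eqVneq Z set0; first by rewrite cards0 muln0.
have := Ymin Z; rewrite /P ZA Z0 => /(_ isT).
rewrite /F ler_pdivrMr ?ltr0n ?card_gt0 // mulrAC ler_pdivlMr ?ltr0n ?card_gt0 //.
by rewrite -!natrM ler_nat.
Qed.

(* Petridis: adding one element [c] to [C] enlarges [Y + A + C] by at most
   [(Y + A + c) \ (Z + A + c)], where [Z] collects the [y] whose translate
   [y + A + c] is already covered; minimality of [Y] is applied to [Z]. *)
Lemma min_expanding_sumset A Y C : Y \subset A -> min_expanding A Y ->
  (#|sumset (sumset Y A) C| * #|Y| <= #|sumset Y A| * #|sumset Y C|)%N.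
Proof.
move=> YA Ymin; have [n] := ubnP #|C|; elim: n C => // n IHn C.
have [->|[c cC]] := set_0Vmem C.
  rewrite (_ : sumset _ set0 = set0) ?cards0 //.
  by apply/setP => x; rewrite inE; apply/negP => /sumsetP[a [b []]]; rewrite inE.
rewrite (cardsD1 c C) cC ltnS => /IHn; set C' := C :\ c; set T := sumset _ C'.
have C'C : C' \subset C by apply: subD1set.
move=> IH.
pose Z := [set y in Y | [forall a in A, y + a + c \in T]].
have ZY : Z \subset Y by apply/subsetP => y; rewrite inE => /andP[].
have H1 : (#|sumset (sumset Y A) C| + #|sumset Z A| <= #|T| + #|sumset Y A|)%N.
  have ZAYA : sumset Z A \subset sumset Y A by apply: sumsetS.
  have : sumset (sumset Y A) C \subset
      T :|: sumset (sumset Y A :\: sumset Z A) [set c].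
    apply/subsetP => x /sumsetP[u [d [uYA dC ->]]].
    have [dc|dc] := eqVneq d c; last by rewrite inE mem_sumset // !inE dc.
    rewrite {d dC}dc inE; have [/sumsetP[z [a [zZ aA ->]]]|uZ] := boolP (u \in sumset Z A).
      by move: zZ; rewrite inE => /andP[_ /forall_inP/(_ a aA) ->].
    by apply/orP; right; apply: mem_sumset; rewrite ?inE ?uZ ?uYA.
  move=> /subset_leq_card/leq_trans/(_ (leq_card_setU _ _)).
  rewrite card_sumset1 cardsD (setIidPr ZAYA).
  by have := subset_leq_card ZAYA; lia.
have H2 : (#|sumset Y C'| + #|Y| <= #|sumset Y C| + #|Z|)%N.
  have : sumset Y C' :|: sumset (Y :\: Z) [set c] \subset sumset Y C.
    by rewrite subUset !sumsetS ?subsetDl ?sub1set.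
  move=> /subset_leq_card; rewrite cardsU card_sumset1 cardsD (setIidPr ZY).
  rewrite (_ : _ :&: _ = set0) ?cards0.
    by have := subset_leq_card ZY; lia.
  (* If [y + c = y' + c'] with [c'] in [C'], then [y + a + c = y' + a + c'] is in [T] for every [a]
     in [A], which puts [y] in [Z]. *)
  apply/setP => x; rewrite !inE; apply/negP => /andP[/sumsetP[y' [c' [y'Y c'C ->]]]].
  move=> /sumsetP[y [d [+ /set1P -> e]]]; rewrite !inE => /andP[/negP + yY]; apply.
  rewrite yY; apply/forall_inP => a aA.
  rewrite addrAC -e addrAC; apply: mem_sumset => //; exact: mem_sumset.
have := Ymin Z (subset_trans ZY YA); nia.
Qed.

Lemma min_expanding_double A Y : Y \subset A -> min_expanding A Y ->
  (#|sumset (sumset Y A) A| * #|Y| <= #|sumset Y A| ^ 2)%N.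
Proof. by move=> YA Ymin; rewrite -mulnn min_expanding_sumset. Qed.

Definition diffset A B : {set G} := [set a - b | a in A, b in B].

(* Ruzsa's injection [(a1 - a2, a) |-> (a1 + a, a2 + a)]. *)
Lemma card_diffset A : (#|diffset A A| * #|A| <= #|sumset A A| ^ 2)%N.
Proof.
pose r d := odflt (0, 0) [pick p : G * G | [&& p.1 \in A, p.2 \in A & d == p.1 - p.2]].
have rP d : d \in diffset A A -> [/\ (r d).1 \in A, (r d).2 \in A & d = (r d).1 - (r d).2].
  rewrite /r => /imset2P[a b aA bA dab]; case: pickP => [p /and3P[? ? /eqP ?] //|].
  by move=> /(_ (a, b)) /=; rewrite aA bA dab eqxx.
pose f (q : G * G) := ((r q.1).1 + q.2, (r q.1).2 + q.2).
rewrite -mulnn -!cardsX -(@card_in_imset _ _ f).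
  apply/subset_leq_card/subsetP => _ /imsetP[[d a] /setXP[/rP[? ? _] aA] ->].
  by rewrite inE /= !mem_sumset.
move=> [d a] [d' a'] /setXP[/rP[_ _ dE] aA] /setXP[/rP[_ _ dE'] aA'] [/= e1 e2].
have e : d = d'.
  rewrite dE dE'; apply/eqP; rewrite subr_eq addrAC -subr_eq opprK; apply/eqP.
  by apply: (addIr (a + a')); rewrite addrACA e1 [a + a']addrC [RHS]addrACA e2.
by move: e1; rewrite e => /addrI ->.
Qed.

(** * Covering by translates, and growth of iterated sumsets *)

Definition covering A Y X :=
  forall t, t \in sumset A A ->
    (#|Y| < 2 * #|[set y in Y | (t + y)%R \in sumset X Y]|)%N.

(** Take [X] of maximal size with [(|X| + 1) |Y| <= 2 |X + Y|]. A [t] covered on at most half of [Y]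
    would add at least [|Y| / 2] new elements to [X + Y], so [t |: X] would be a larger such set. *)
Lemma exists_covering A Y : A != set0 -> Y \subset A -> Y != set0 ->
  exists X, [/\ X \subset sumset A A, X != set0, covering A Y X
    & (#|X|.+1 * #|Y| <= 2 * #|sumset (sumset Y A) A|)%N].
Proof.
move=> A0 YA Y0.
pose P (X : {set G}) := [&& X \subset sumset A A, X != set0 &
  (#|X|.+1 * #|Y| <= 2 * #|sumset X Y|)%N].
have [a aA] := set0Pn _ A0.
have P1 : P [set a + a].
  apply/and3P; split; first by rewrite sub1set mem_sumset.
    by apply/set0Pn; exists (a + a); rewrite inE.
  rewrite cards1 leq_mul2l /=; rewrite -[X in (X <= _)%N](card_sumset1 Y (a + a)).
  apply/subset_leq_card/subsetP => x /sumsetP[y [b [yY bE ->]]].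
  by rewrite addrC mem_sumset.
case: (arg_maxnP (fun X : {set G} => #|X|) P1) => X /and3P[XA X0 Xc] Xmax.
exists X; split=> //.
- move=> t tA; set W := [set y in Y | _].
  have WY : W \subset Y by apply/subsetP => y; rewrite inE => /andP[].
  have [tX|tX] := boolP (t \in X).
    have -> : W = Y.
      apply/setP => y; rewrite inE; case: (boolP (y \in Y)) => //= yY.
      exact: mem_sumset.
    by move: Y0; rewrite -card_gt0; lia.
  have card1 : #|t |: X| = #|X|.+1 by rewrite cardsU1 tX.
  have : ~~ P (t |: X).
    by apply/negP => /Xmax /=; rewrite card1 ltnn.
  have tX0 : t |: X != set0 by apply/set0Pn; exists t; rewrite setU11.
  rewrite /P subUset sub1set tA XA tX0 card1 /= -ltnNge => lt.
  have : sumset X Y :|: sumset (Y :\: W) [set t] \subset sumset (t |: X) Y.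
    rewrite subUset sumsetS ?subsetUr //=; apply/subsetP => x.
    move=> /sumsetP[y [b [/setDP[yY _] /set1P -> ->]]]; rewrite addrC.
    by rewrite mem_sumset ?setU11.
  move=> /subset_leq_card; rewrite cardsU card_sumset1 cardsD (setIidPr WY).
  rewrite (_ : _ :&: _ = set0) ?cards0.
    move: lt Xc; rewrite (mulSn #|X|.+1); move: (#|X|.+1 * #|Y|)%N => q.
    have := subset_leq_card WY.
    by move: #|sumset (_ |: X) Y| #|sumset X Y| #|W| #|Y| => u v w y; clear; lia.
  apply/setP => x; rewrite !inE; apply/negP => /andP[+ /sumsetP[y [b [+ /set1P -> e]]]].
  by rewrite e addrC !inE => h /andP[/negP + yY]; rewrite yY h; apply.
- apply: leq_trans Xc _; rewrite leq_mul2l /=.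
  apply/subset_leq_card/subsetP => x /sumsetP[z [y [zX yY ->]]].
  have /sumsetP[b [c [bA cA ->]]] := subsetP XA z zX.
  by rewrite addrC addrA !mem_sumset.
Qed.

(* Two majorities in [Y] meet, so [t] and [t'] are covered through a common [y]. *)
Lemma covering_diff A Y X t t' : covering A Y X ->
  t \in sumset A A -> t' \in sumset A A ->
  exists x x' y y', [/\ x \in X, x' \in X, y \in Y, y' \in Y
    & t - t' = x - x' + (y - y')].
Proof.
move=> cov /cov; set W := [set y in Y | _] => ct /cov; set W' := [set y in Y | _] => ct'.
have /set0Pn[y0] : W :&: W' != set0.
  rewrite -card_gt0; have : (#|W :|: W'| <= #|Y|)%N.
    by apply/subset_leq_card/subsetP => y; rewrite !inE => /orP[]/andP[].
  by rewrite cardsU; have := subset_leq_card (subsetIl W W'); lia.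
rewrite !inE => /andP[/andP[_ /sumsetP[x [y [xX yY e]]]]].
move=> /andP[_ /sumsetP[x' [y' [x'X y'Y e']]]].
exists x, x', y, y'; split=> //.
by rewrite -[LHS](addrKA y0) [y0 + t']addrC e e' opprD addrACA.
Qed.

Definition iter_sumset A B n : {set G} := iter n (fun S => sumset S B) A.

(* Each element of [A + n (X + Y)] is a fixed translate of an element of
   [2n X - n X + (A - A)]; the shift by [n] keeps the coefficients in [nat]. *)
Lemma iter_sumset_repr A Y X a0 y0 n s : Y \subset A -> covering A Y X ->
  a0 \in A -> y0 \in Y -> s \in iter_sumset A (sumset X Y) n ->
  exists c : G -> nat, exists a a' : G,
  [/\ forall x, (c x <= 3 * n)%N, a \in A, a' \in A
    & s = a0 + (y0 - \sum_(x in X) x) *+ n + \sum_(x in X) x *+ c x + (a - a')].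
Proof.
move=> YA cov a0A y0Y; have a0A' := subsetP YA _ y0Y; elim: n s => [|n IHn] s.
  move=> sA; exists (fun=> 0%N), s, a0; split=> //.
  by rewrite mulr0n big1 // !addr0 addrC subrK.
rewrite /iter_sumset iterS => /sumsetP[s' [z [/IHn[c [a [a' [cn aA a'A ->]]]]]]].
case=> /sumsetP[x0 [y [x0X yY ->]]] ->.
(* The old [a - a'] and the new [y] add up to [(a + y) - (a' + y0) + y0], which the covering
   rewrites as [x1 - x2 + (y1 - y2) + y0]. *)
have [x1 [x2 [y1 [y2 [x1X x2X y1Y y2Y e]]]]] :=
  @covering_diff A Y X (a + y) (a' + y0) cov
    (mem_sumset aA (subsetP YA _ yY)) (mem_sumset a'A a0A').
(* The term [- x2] becomes minus the sum of [X], absorbed by the shift, plus the sum over all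
   [x != x2]; so a coefficient grows by at most 3. *)
exists (fun x => c x + (x == x0) + (x == x1) + (x != x2))%N, y1, y2.
split; [move=> x|exact: (subsetP YA)|exact: (subsetP YA)|].
  move: (cn x) (x == x0) (x == x1) (x != x2); clear => + b0 b1 b2.
  by have := leq_b1 b0; have := leq_b1 b1; have := leq_b1 b2;
    move: (nat_of_bool b0) (nat_of_bool b1) (nat_of_bool b2); lia.
have dlt u : u \in X -> \sum_(x in X) x *+ (x == u) = u.
  move=> uX; rewrite (bigD1 u) //= eqxx mulr1n big1 ?addr0 //.
  by move=> i /andP[_ /negPf ->].
have -> : \sum_(x in X) x *+ (c x + (x == x0) + (x == x1) + (x != x2)) =
    \sum_(x in X) x *+ c x + x0 + x1 + \sum_(x in X) x *+ (x != x2).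
  rewrite -[in RHS](dlt x0) // -[in RHS](dlt x1) // -!big_split /=.
  by apply: eq_bigr => x _; rewrite !mulrnDr.
have -> : \sum_(x in X) x *+ (x != x2) = \sum_(x in X) x - x2.
  rewrite -[in RHS](dlt x2) // -sumrB; apply: eq_bigr => x _.
  by case: (x == x2); rewrite /= ?subrr ?subr0.
have -> : a - a' = x1 - x2 + (y1 - y2) + y0 - y.
  by rewrite -e opprD !addrA subrK addrAC addrK.
set SX := \sum_(x in X) x; set SC := \sum_(x in X) x *+ c x.
rewrite mulrSr; set D := _ *+ n; rewrite !addrA.
rewrite [LHS](ACl (1*2*8*3*10*4*5*6*7*9*11)) /= subrK.
by rewrite [RHS](ACl (1*2*3*5*6*7*9*10*11*4*8)) /= subrK.
Qed.

Lemma card_iter_sumset A Y X n : Y \subset A -> Y != set0 -> covering A Y X ->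
  (#|iter_sumset A (sumset X Y) n| <= (3 * n).+1 ^ #|X| * #|diffset A A|)%N.
Proof.
move=> YA /set0Pn[y0 y0Y] cov; have a0A := subsetP YA _ y0Y.
pose f (p : {ffun 'I_#|X| -> 'I_(3 * n).+1} * G) : G :=
  y0 + (y0 - \sum_(x in X) x) *+ n + \sum_(i < #|X|) enum_val i *+ p.1 i + p.2.
have -> : ((3 * n).+1 ^ #|X|)%N = #|[set: {ffun 'I_#|X| -> 'I_(3 * n).+1}]|.
  by rewrite cardsT card_ffun !card_ord.
rewrite -cardsX; apply: leq_trans (leq_imset_card f _).
apply/subset_leq_card/subsetP => s /(iter_sumset_repr YA cov a0A y0Y).
case=> c [a [a' [cn aA a'A ->]]]; apply/imsetP.
exists ([ffun i => inord (c (enum_val i))], a - a').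
  by rewrite !inE /=; apply: imset2_f.
rewrite /f /=; congr (_ + _ + _); rewrite big_enum_val; apply: eq_bigr => i _.
by rewrite ffunE inordK // ltnS.
Qed.

End Sumsets.

(** * Fourier analysis in real coordinates *)

Section Fourier.
Variables (R : realFieldType) (G : finComNzRingType).

(* The real and imaginary parts of an additive character whose multiples
   [x |-> chi (r * x)] are all the characters of [G]. *)
Record character := Character {
  char_re : G -> R;
  char_im : G -> R;
  co0 : char_re 0 = 1;
  si0 : char_im 0 = 0;
  coD : forall x y, char_re (x + y) = char_re x * char_re y - char_im x * char_im y;
  siD : forall x y, char_im (x + y) = char_im x * char_re y + char_re x * char_im y;
  coN : forall x, char_re (- x) = char_re x;
  siN : forall x, char_im (- x) = - char_im x;
  co2Dsi2 : forall x, char_re x ^+ 2 + char_im x ^+ 2 = 1;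
  sum_co : forall x, \sum_r char_re (r * x) = #|G|%:R *+ (x == 0) }.

Variable chi : character.
Implicit Types (f g : G -> R) (r : G) (A B X Y : {set G}).

Local Notation co := (char_re chi).
Local Notation si := (char_im chi).

(** The real and imaginary parts of a Fourier coefficient; [energy] is its squared modulus. *)
Definition fourier_co f r := \sum_x f x * co (r * x).
Definition fourier_si f r := \sum_x f x * si (r * x).
Definition energy f r := fourier_co f r ^+ 2 + fourier_si f r ^+ 2.
Definition conv f g z := \sum_x f x * g (z - x).
Definition ind A x : R := (x \in A)%:R.

Lemma co_mulD r x y :
  co (r * (x + y)) = co (r * x) * co (r * y) - si (r * x) * si (r * y).
Proof. by rewrite mulrDr coD. Qed.

Lemma si_mulD r x y :
  si (r * (x + y)) = si (r * x) * co (r * y) + co (r * x) * si (r * y).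
Proof. by rewrite mulrDr siD. Qed.

Lemma co_mulB r x y :
  co (r * (x - y)) = co (r * x) * co (r * y) + si (r * x) * si (r * y).
Proof. by rewrite mulrBr coD coN siN mulrN opprK. Qed.

Lemma energyE f r : energy f r = \sum_x \sum_y f x * f y * co (r * (x - y)).
Proof.
rewrite /energy /fourier_co /fourier_si !expr2 !mulr_suml /= -big_split /=.
apply: eq_bigr => x _; rewrite !mulr_sumr /= -big_split /=.
by apply: eq_bigr => y _; rewrite co_mulB; ring.
Qed.

Lemma parseval f : \sum_r energy f r = #|G|%:R * \sum_x f x ^+ 2.
Proof.
under eq_bigr => r _ do rewrite energyE.
rewrite exchange_big /= mulr_sumr /=; apply: eq_bigr => x _.
rewrite exchange_big /= (bigD1 x) //= [X in _ + X]big1 => [|y yx].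
  by rewrite -mulr_sumr /= subrr sum_co eqxx mulr1n; ring.
by rewrite -mulr_sumr /= sum_co subr_eq0 eq_sym (negPf yx) mulr0n mulr0.
Qed.

Lemma big_conv f g (F : G -> R) :
  \sum_z conv f g z * F z = \sum_x \sum_y f x * g y * F (x + y).
Proof.
under eq_bigr => z _ do rewrite /conv mulr_suml /=.
rewrite exchange_big /=; apply: eq_bigr => x _.
rewrite (reindex_inj (addrI x)) /=; apply: eq_bigr => y _.
by rewrite addrAC subrr add0r.
Qed.

(** The transform turns convolution into a product; the last [ring] is the two-square identity. *)
Lemma energy_conv f g r : energy (conv f g) r = energy f r * energy g r.
Proof.
have -> : energy (conv f g) r =
    (fourier_co f r * fourier_co g r - fourier_si f r * fourier_si g r) ^+ 2 +
    (fourier_si f r * fourier_co g r + fourier_co f r * fourier_si g r) ^+ 2.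
  rewrite /energy [fourier_co (conv f g) r]big_conv [fourier_si (conv f g) r]big_conv.
  congr (_ ^+ 2 + _ ^+ 2); rewrite /fourier_co /fourier_si !mulr_suml /=;
    rewrite -?sumrB -?big_split /=; apply: eq_bigr => x _;
    rewrite !mulr_sumr /= -?sumrB -?big_split /=; apply: eq_bigr => y _;
    by rewrite ?co_mulD ?si_mulD; ring.
by rewrite /energy; ring.
Qed.

Lemma sum_conv f g : \sum_z conv f g z = (\sum_x f x) * (\sum_x g x).
Proof.
under eq_bigr => z _ do rewrite -[conv f g z]mulr1.
rewrite (big_conv f g (fun=> 1)) mulr_suml /=; apply: eq_bigr => x _.
by rewrite mulr_sumr /=; apply: eq_bigr => y _; rewrite mulr1.
Qed.

Lemma energy_ge0 f r : 0 <= energy f r.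
Proof. by rewrite addr_ge0 ?sqr_ge0. Qed.

Lemma energy0 f : energy f 0 = (\sum_x f x) ^+ 2.
Proof.
rewrite /energy /fourier_co /fourier_si [X in _ + X ^+ 2]big1 ?expr0n ?addr0.
  by congr (_ ^+ 2); apply: eq_bigr => x _; rewrite mul0r co0 mulr1.
by move=> x _; rewrite mul0r si0 mulr0.
Qed.

Lemma big_ind_set A (F : G -> R) : \sum_x ind A x * F x = \sum_(x in A) F x.
Proof.
rewrite [RHS]big_mkcond /=; apply: eq_bigr => x _.
by rewrite /ind; case: (x \in A); rewrite ?mul1r ?mul0r.
Qed.

Lemma sum_ind A : \sum_x ind A x = #|A|%:R.
Proof.
under eq_bigr => x _ do rewrite -[ind A x]mulr1.
by rewrite (big_ind_set A (fun=> 1)) sumr_const.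
Qed.

Lemma energy_ind A r :
  energy (ind A) r = \sum_(a in A) \sum_(b in A) co (r * (a - b)).
Proof.
rewrite energyE -big_ind_set; apply: eq_bigr => x _.
by rewrite -big_ind_set mulr_sumr /=; apply: eq_bigr => y _; rewrite mulrA.
Qed.

Lemma co_le1 x : co x <= 1.
Proof. by have := co2Dsi2 chi x; have := sqr_ge0 (si x); nra. Qed.

Lemma energy_ind_le A r : energy (ind A) r <= #|A|%:R ^+ 2.
Proof.
rewrite energy_ind expr2 mulr_natl -sumr_const.
apply: ler_sum => a _; rewrite -sumr_const; apply: ler_sum => b _; exact: co_le1.
Qed.

(** Cauchy-Schwarz by Lagrange's identity: twice the defect is the sum of [(f x - f y) ^+ 2] over
    pairs from [S]. *)
Lemma sum_sqr_support (S : {set G}) f : (forall x, x \notin S -> f x = 0) ->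
  (\sum_x f x) ^+ 2 <= #|S|%:R * \sum_x f x ^+ 2.
Proof.
move=> fS.
have toS (F : G -> R) : (forall x, x \notin S -> F x = 0) -> \sum_x F x = \sum_(x in S) F x.
  move=> FS; rewrite [RHS]big_mkcond /=; apply: eq_bigr => x _.
  by case: ifPn => // /FS.
rewrite toS // [X in _ * X]toS => [|x /fS ->]; last by rewrite expr0n.
have : 0 <= \sum_(x in S) \sum_(y in S) (f x - f y) ^+ 2.
  by apply: sumr_ge0 => x _; apply: sumr_ge0 => y _; apply: sqr_ge0.
set a := \sum_(x in S) f x; set b := \sum_(x in S) f x ^+ 2.
have -> : \sum_(x in S) \sum_(y in S) (f x - f y) ^+ 2 = 2 * (#|S|%:R * b - a ^+ 2).
  transitivity (\sum_(x in S) (#|S|%:R * f x ^+ 2 + b - 2 * f x * a)).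
    apply: eq_bigr => x _.
    rewrite mulr_natl -sumr_const /a /b mulr_sumr /= -big_split -sumrB /=.
    by apply: eq_bigr => y _; ring.
  rewrite sumrB big_split /= sumr_const -mulr_sumr -mulr_suml /= -mulr_sumr /=.
  by rewrite -/a -/b -mulr_natl; ring.
lra.
Qed.

Definition iter_conv A X Y n : G -> R :=
  iter n (fun f => conv f (conv (ind X) (ind Y))) (ind A).

Lemma energy_iter_conv A X Y n r : energy (iter_conv A X Y n) r =
  energy (ind A) r * (energy (ind X) r * energy (ind Y) r) ^+ n.
Proof.
elim: n => [|n IHn]; first by rewrite expr0 mulr1.
by rewrite [iter_conv _ _ _ _]iterS !energy_conv -/(iter_conv A X Y n) IHn exprSr -mulrA.
Qed.

Lemma sum_iter_conv A X Y n :
  \sum_x iter_conv A X Y n x = #|A|%:R * (#|X|%:R * #|Y|%:R) ^+ n.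
Proof.
elim: n => [|n IHn]; first by rewrite expr0 mulr1 sum_ind.
by rewrite [iter_conv _ _ _ _]iterS !sum_conv !sum_ind -/(iter_conv A X Y n) IHn exprSr -mulrA.
Qed.

Lemma conv_support f g A B : (forall x, x \notin A -> f x = 0) ->
  (forall x, x \notin B -> g x = 0) ->
  forall x, x \notin sumset A B -> conv f g x = 0.
Proof.
move=> fA gB z zAB; rewrite /conv big1 // => x _.
have [xA|/fA ->] := boolP (x \in A); last by rewrite mul0r.
have [yB|/gB ->] := boolP (z - x \in B); last by rewrite mulr0.
by case/negP: zAB; rewrite -[z](subrK x) addrC mem_sumset.
Qed.

Lemma iter_conv_support A X Y n x :
  x \notin iter_sumset A (sumset X Y) n -> iter_conv A X Y n x = 0.
Proof.
have indN B y : y \notin B -> ind B y = 0 by rewrite /ind => /negPf ->.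
elim: n x => [|n IHn] x; first exact: indN.
rewrite /iter_sumset /iter_conv !iterS; apply: conv_support => // y.
by apply: conv_support => z; apply: indN.
Qed.

(* Cauchy-Schwarz on the support of the iterated convolution, whose second
   moment is bounded through Parseval. *)
Lemma small_energy_growth A X Y n (eps : R) : A != set0 -> X != set0 -> Y != set0 ->
  eps <= 1 ->
  (forall r, r != 0 -> energy (ind X) r * energy (ind Y) r <=
     (1 - eps) * (#|X|%:R * #|Y|%:R) ^+ 2) ->
  #|G|%:R * #|A|%:R <= #|iter_sumset A (sumset X Y) n|%:R *
    (#|A|%:R + (1 - eps) ^+ n * #|G|%:R).
Proof.
move=> A0 X0 Y0 eps1 small.
set S := iter_sumset _ _ _; set q := #|X|%:R * #|Y|%:R : R.
have q0 : 0 < q by rewrite mulr_gt0 ?ltr0n ?card_gt0.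
have a0 : 0 < #|A|%:R :> R by rewrite ltr0n card_gt0.
pose f := iter_conv A X Y n.
have cs := @sum_sqr_support S f (@iter_conv_support A X Y n).
(* Frequency 0 contributes the square of the total mass; the others carry at most
   [(1 - eps) ^+ n * q ^+ (2 * n)] times the energy of [A], whose sum is at most [|G| |A|]. *)
have par : #|G|%:R * \sum_x f x ^+ 2 <=
    (#|A|%:R * q ^+ n) ^+ 2 + (1 - eps) ^+ n * q ^+ (2 * n) * (#|G|%:R * #|A|%:R).
  rewrite -parseval (bigD1 0) //= energy0 sum_iter_conv lerD2l.
  apply: (@le_trans _ _ (\sum_(r | r != 0) energy (ind A) r * ((1 - eps) ^+ n * q ^+ (2 * n)))).
    apply: ler_sum => r r0; rewrite energy_iter_conv ler_wpM2l ?energy_ge0 //.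
    rewrite exprM -exprMn; apply: lerXn2r; rewrite ?small // nnegrE.
      by rewrite mulr_ge0 ?energy_ge0.
    by rewrite mulr_ge0 ?sqr_ge0 ?subr_ge0.
  have ge0 : 0 <= (1 - eps) ^+ n * q ^+ (2 * n).
    by rewrite mulr_ge0 ?exprn_ge0 ?subr_ge0 // ltW.
  rewrite -mulr_suml /= mulrC ler_wpM2l //.
  have -> : #|G|%:R * #|A|%:R = \sum_r energy (ind A) r.
    rewrite parseval; congr (_ * _); rewrite -sum_ind.
    by apply: eq_bigr => x _; rewrite /ind; case: (x \in A); rewrite ?expr1n ?expr0n.
  by rewrite [leRHS](bigD1 0) //= lerDr energy_ge0.
rewrite -(ler_pM2l (mulr_gt0 a0 (exprn_gt0 2 (exprn_gt0 n q0)))).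
have h2 := ler_wpM2l (ler0n R #|S|) par.
have h1 := ler_wpM2l (ler0n R #|G|) cs.
move: h1 h2; rewrite sum_iter_conv -/q [(2 * n)%N]mulnC exprM.
move: (\sum_x _) (q ^+ n) #|G|%:R #|S|%:R #|A|%:R ((1 - eps) ^+ n); clear.
by move=> F p N S a e; lra.
Qed.

(** * Concentration of character values near 1 *)

Definition dist x := 1 - co x.

Lemma dist_ge0 x : 0 <= dist x.
Proof. by rewrite subr_ge0 co_le1. Qed.

Lemma distN x : dist (- x) = dist x.
Proof. by rewrite /dist coN. Qed.

(** As [dist x] is half of [|chi x - 1|^2], this is the parallelogram law for [chi x - 1] and
    [conj (chi y) - 1], with the squared modulus of their sum dropped. *)
Lemma distD x y : dist (x + y) <= 2 * dist x + 2 * dist y.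
Proof.
rewrite /dist coD; have := co2Dsi2 chi x; have := co2Dsi2 chi y.
have : 0 <= (co x + co y - 2) ^+ 2 + (si x - si y) ^+ 2 by rewrite addr_ge0 ?sqr_ge0.
by move: (co x) (co y) (si x) (si y) => c c' s s'; lra.
Qed.

(* Averaging over the choice of the centre. *)
Lemma energy_center B r (eps : R) : (1 - eps) * #|B|%:R ^+ 2 < energy (ind B) r ->
  exists2 b, b \in B & \sum_(x in B) dist (r * (x - b)) < eps * #|B|%:R.
Proof.
move=> large; have [/exists_inP[b bB lt]|] :=
  boolP [exists (b | b \in B), \sum_(x in B) dist (r * (x - b)) < eps * #|B|%:R].
  by exists b.
rewrite negb_exists_in => /forall_inP h; exfalso.
have : \sum_(b in B) \sum_(x in B) dist (r * (x - b)) = #|B|%:R ^+ 2 - energy (ind B) r.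
  rewrite energy_ind exchange_big /= expr2 mulr_natl -sumr_const -sumrB.
  by apply: eq_bigr => x _; rewrite sumrB sumr_const.
apply/eqP; rewrite gt_eqF //.
apply: (@lt_le_trans _ _ (eps * #|B|%:R ^+ 2)); first by lra.
rewrite expr2 mulrA mulr_natr -sumr_const; apply: ler_sum => b bB.
by rewrite leNgt h.
Qed.

Lemma card_sumset_le A B : (#|sumset A B| <= #|A| * #|B|)%N.
Proof. by rewrite /sumset curry_imset2X -cardsX leq_imset_card. Qed.

Section Closeness.
Variables (A X Y : {set G}) (r : G) (eps : R).
Hypothesis cov : covering A Y X.
Hypothesis eps0 : 0 < eps.
Variables (x0 y0 : G).
Hypothesis sumX : \sum_(x in X) dist (r * (x - x0)) < eps * #|X|%:R.
Hypothesis sumY : \sum_(y in Y) dist (r * (y - y0)) < eps * #|Y|%:R.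

(* By Markov's inequality fewer than [|Y| / (2 (|X| + 1))] elements of [Y] are
   far from [y0], too few to spoil the majority that covers [t]. *)
Lemma covering_close t : t \in sumset A A ->
  exists x y y', [/\ x \in X, t = x + y' - y,
    dist (r * (y - y0)) < 2 * #|X|.+1%:R * eps &
    dist (r * (y' - y0)) < 2 * #|X|.+1%:R * eps].
Proof.
move=> tA.
pose bad := [set y in Y | 2 * #|X|.+1%:R * eps <= dist (r * (y - y0))].
have badN : (2 * #|X|.+1 * #|bad| < #|Y|)%N.
  rewrite -(ltr_nat R) -(ltr_pM2l eps0); apply: le_lt_trans sumY.
  apply: (@le_trans _ _ (\sum_(y in bad) dist (r * (y - y0)))).
    rewrite (_ : eps * _ = (2 * #|X|.+1%:R * eps) *+ #|bad|); last first.
      by rewrite !natrM -mulr_natr; ring.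
    rewrite -sumr_const.
    by apply: ler_sum => y; rewrite inE => /andP[].
  rewrite [leRHS](big_setID bad) /=.
  have -> : Y :&: bad = bad.
    by apply/setIidPr/subsetP => y; rewrite inE => /andP[].
  by rewrite lerDl sumr_ge0 // => y _; apply: dist_ge0.
have := cov tA; set W := [set y in Y | _] => Wbig.
(* The right-hand set has at most [(|X| + 1) |bad| < |Y| / 2] elements, so some good [y] in [W] has
   [t + y = x + y'] with [y'] good too. *)
have /subsetPn[y] : ~~ (W \subset bad :|: sumset (sumset X bad) [set - t]).
  apply/negP => /subset_leq_card.
  move=> /leq_trans/(_ (leq_card_setU _ _)); rewrite card_sumset1.
  have := card_sumset_le X bad; move: badN Wbig.
  move: #|W| #|Y| #|sumset X bad| #|X| #|bad| => w y s x b; clear; nia.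
rewrite inE => /andP[yY /sumsetP[x [y' [xX y'Y e]]]].
have tE : t = x + y' - y by rewrite -e addrK.
rewrite inE negb_or => /andP[ybad y'bad]; exists x, y, y'; split=> //.
  by move: ybad; rewrite inE yY -ltNge.
rewrite ltNge; apply: contra y'bad => y'far; apply/sumsetP.
exists (x + y'), (- t); split; [|by rewrite inE|by rewrite -e addrC addKr].
by rewrite mem_sumset // inE y'Y.
Qed.

(** Write [a - b = (a + b) - (b + b)] and decompose both sums by [covering_close]. In units of
    [(|X| + 1) eps], repeated use of [distD] gives 4 for the [X] part and 32 for the [Y] part, and
    [2 * 4 + 2 * 32 = 72]. *)
Lemma covering_dist a b : a \in A -> b \in A ->
  dist (r * (a - b)) <= 72 * #|X|.+1%:R * eps.
Proof.
move=> aA bA.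
have [x [y [y' [xX e dy dy']]]] := covering_close (mem_sumset aA bA).
have [x1 [z [z' [x1X e1 dz dz']]]] := covering_close (mem_sumset bA bA).
have dX u : u \in X -> dist (r * (u - x0)) < eps * #|X|.+1%:R.
  move=> uX; apply: (@lt_le_trans _ _ (eps * #|X|%:R)); last first.
    by apply: ler_wpM2l; [exact: ltW|rewrite ler_nat].
  apply: le_lt_trans sumX; rewrite (bigD1 u) //= lerDl sumr_ge0 // => v _.
  exact: dist_ge0.
have -> : r * (a - b) = (r * (x - x0) - r * (x1 - x0)) +
    ((r * (y' - y0) - r * (z' - y0)) - (r * (y - y0) - r * (z - y0))).
  have -> : a - b = (x + y' - y) - (x1 + z' - z) by rewrite -e -e1; ring.
  by ring.
have := dX x xX; have := dX x1 x1X; move: dy dy' dz dz'.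
have := distD (r * (x - x0) - r * (x1 - x0))
    ((r * (y' - y0) - r * (z' - y0)) - (r * (y - y0) - r * (z - y0))).
have := distD (r * (x - x0)) (- (r * (x1 - x0))).
have := distD (r * (y' - y0) - r * (z' - y0)) (- (r * (y - y0) - r * (z - y0))).
have := distD (r * (y' - y0)) (- (r * (z' - y0))).
have := distD (r * (y - y0)) (- (r * (z - y0))).
rewrite !distN; lra.
Qed.

End Closeness.

(** Neither energy exceeds its trivial bound, so if the product is nearly maximal then so is each
    factor, and [energy_center] provides both centres. *)
Lemma large_energy_dist A X Y r (eps : R) : X != set0 -> Y != set0 ->
  covering A Y X -> 0 < eps -> eps <= 1 ->
  (1 - eps) * (#|X|%:R * #|Y|%:R) ^+ 2 < energy (ind X) r * energy (ind Y) r ->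
  forall a b, a \in A -> b \in A -> dist (r * (a - b)) <= 72 * #|X|.+1%:R * eps.
Proof.
move=> X0 Y0 cov eps0 eps1 large a b.
have big Z Z' : energy (ind Z) r * energy (ind Z') r = energy (ind X) r * energy (ind Y) r ->
    #|Z|%:R * #|Z'|%:R = #|X|%:R * #|Y|%:R :> R ->
    (1 - eps) * #|Z|%:R ^+ 2 < energy (ind Z) r.
  move=> eE ec; rewrite ltNge; apply/negP => small.
  move: large; rewrite -eE -ec ltNge => /negP; apply.
  rewrite exprMn mulrA; apply: ler_pM => //; rewrite ?energy_ge0 ?energy_ind_le //.
have [x0 x0X sumX] := energy_center (big X Y erefl erefl).
have [y0 y0Y sumY] := energy_center (big Y X (mulrC _ _) (mulrC _ _)).
exact: (covering_dist cov eps0 sumX sumY).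
Qed.

End Fourier.

(** * Cosine estimate, characters of the cyclic group and lifting to the integers *)

Lemma sqr_le_1Bcos (R : realType) (t : R) : 0 <= t -> t <= pi ->
  t ^+ 2 <= pi ^+ 2 * (1 - cos t).
Proof.
move=> t0 tpi; have pi0 := pi_gt0 R.
have [->|tn0] := eqVneq t 0; first by rewrite expr0n mulr_ge0 ?sqr_ge0 ?subr_ge0 ?cos_le1.
have tgt0 : 0 < t by rewrite lt_neqAle eq_sym tn0.
(* Here the cosine is non-positive, so [u <= pi] suffices. *)
have big (u : R) : pi / 2 <= u -> u <= pi -> u ^+ 2 <= pi ^+ 2 * (1 - cos u).
  move=> u1 u2.
  have : cos u <= 0.
    rewrite -oppr_ge0 -[u](subrK pi) cosDpi opprK cos_ge0_pihalf //; lra.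
  by move=> cu; nra.
(* [1 - cos (2 t) <= 4 (1 - cos t)]: the claim for [2 t] implies it for [t]. *)
suff H n : forall u : R, 0 <= u -> u <= pi -> pi / 2 <= u * 2 ^+ n ->
    u ^+ 2 <= pi ^+ 2 * (1 - cos u).
  apply: (H (Num.Def.archi_bound (pi / 2 / t)) t t0 tpi).
  by rewrite -ler_pdivrMl // mulrC ltW // upper_nthrootP.
elim: n => [|n IHn] u u0 upi; first by rewrite expr0 mulr1 => /big; apply.
rewrite exprS mulrA => un; have [/big|ul] := leP (pi / 2) u; first by apply.
have u20 : 0 <= u * 2 by lra.
have u2pi : u * 2 <= pi by lra.
have := IHn (u * 2) u20 u2pi un; rewrite [in cos _]mulr_natr cos_mulr2n.
have := cos_le1 u; have := cos_geN1 u; move: (cos u) => c.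
have : 0 < pi ^+ 2 :> R by rewrite exprn_gt0.
move: (pi ^+ 2) => P; clear => P0 c1 c2.
have : P * (1 - c) * (1 + c) <= P * (1 - c) * 2 by rewrite ler_wpM2l ?mulr_ge0 //; lra.
rewrite -mulr_natr; lra.
Qed.

Section CyclicCharacter.
Variables (R : realType) (p : nat).
Local Notation N := p.+2.

Definition zarg (n : nat) : R := pi *+ 2 * n%:R / N%:R.

Lemma zargD m n : zarg (m + n) = zarg m + zarg n.
Proof. by rewrite /zarg natrD mulrDr mulrDl. Qed.

Lemma zargN n : zarg (n * N) = (pi *+ 2) *+ n.
Proof. by rewrite /zarg natrM mulrA mulfK ?pnatr_eq0 // mulr_natr. Qed.

Lemma cosD2pin (x : R) n : cos (x + (pi *+ 2) *+ n) = cos x.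
Proof. by elim: n => [|n IHn]; rewrite ?addr0 // mulrSr addrA cosD2pi. Qed.

Lemma sinD2pin (x : R) n : sin (x + (pi *+ 2) *+ n) = sin x.
Proof. by elim: n => [|n IHn]; rewrite ?addr0 // mulrSr addrA sinD2pi. Qed.

Lemma cos_zarg_mod n : cos (zarg (n %% N)) = cos (zarg n).
Proof. by rewrite [in RHS](divn_eq n N) addnC zargD zargN cosD2pin. Qed.

Lemma sin_zarg_mod n : sin (zarg (n %% N)) = sin (zarg n).
Proof. by rewrite [in RHS](divn_eq n N) addnC zargD zargN sinD2pin. Qed.

Definition cyc_co (x : 'Z_N) : R := cos (zarg x).
Definition cyc_si (x : 'Z_N) : R := sin (zarg x).

Lemma cyc_coD x y : cyc_co (x + y) = cyc_co x * cyc_co y - cyc_si x * cyc_si y.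
Proof. by rewrite /cyc_co /= cos_zarg_mod zargD cosD. Qed.

Lemma cyc_siD x y : cyc_si (x + y) = cyc_si x * cyc_co y + cyc_co x * cyc_si y.
Proof. by rewrite /cyc_si /= sin_zarg_mod zargD sinD. Qed.

Lemma zargBN (x : 'Z_N) : zarg (N - x) = - zarg x + (pi *+ 2) *+ 1.
Proof.
have := zargD (N - x) x; rewrite subnK; last exact: ltnW.
by rewrite -[X in zarg X]mul1n zargN => ->; rewrite addrCA addNr addr0.
Qed.

Lemma cyc_coN x : cyc_co (- x) = cyc_co x.
Proof. by rewrite /cyc_co /= cos_zarg_mod zargBN cosD2pin cosN. Qed.

Lemma cyc_siN x : cyc_si (- x) = - cyc_si x.
Proof. by rewrite /cyc_si /= sin_zarg_mod zargBN sinD2pin sinN. Qed.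

(** The representative of least absolute value, in [(-N/2, N/2]]. *)
Definition centered (x : 'Z_N) : int :=
  if (2 * x <= N)%N then (x : nat)%:Z else (x : nat)%:Z - N%:Z.

Lemma centered_intr x : (centered x)%:~R = x.
Proof.
rewrite /centered; case: ifP => _; rewrite ?rmorphB /= -?pmulrn ?natr_Zp //.
by rewrite -[N in X in _ - X]/(Zp_trunc N).+2 pchar_Zp ?subr0.
Qed.

(** For [w <= N / 2] the angle is [pi * (2 w / N)], and [sqr_le_1Bcos] applies; larger residues are
    reflected, the cosine being even and periodic. *)
Lemma centered_dist x :
  4 * (`|centered x|%N)%:R ^+ 2 <= N%:R ^+ 2 * (1 - cyc_co x).
Proof.
have N0 : 0 < N%:R :> R by rewrite ltr0n.
have pi0 := pi_gt0 R.
have bound w : (2 * w <= N)%N -> 4 * w%:R ^+ 2 <= N%:R ^+ 2 * (1 - cos (zarg w)).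
  move=> wN; have := @sqr_le_1Bcos R (zarg w).
  have wN' : 2 * w%:R <= N%:R :> R by rewrite -natrM ler_nat.
  have e : zarg w = pi * ((2 * w%:R) / N%:R) by rewrite /zarg -mulr_natr; ring.
  have z0 : 0 <= zarg w by rewrite e mulr_ge0 ?divr_ge0 ?mulr_ge0 ?ler0n ?ltW.
  have zpi : zarg w <= pi by rewrite e ger_pMr // ler_pdivrMr // mul1r.
  move=> /(_ z0 zpi); rewrite {1}e exprMn ler_pM2l ?exprn_gt0 //.
  by rewrite exprMn exprVn ler_pdivrMr ?exprn_gt0 // exprMn [X in _ -> _ <= X]mulrC; lra.
rewrite /centered /cyc_co; case: ifPn => [|/negP].
  by move=> ?; rewrite absz_nat; apply: bound.
move=> xN; have xltN := ltn_ord x.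
have -> : `|(x : nat)%:Z - N%:Z|%N = (N - x)%N by exact: distnEr (ltnW xltN).
rewrite -[zarg x]opprK cosN -(cosD2pin _ 1) -zargBN; apply: bound.
by move: xN xltN => /=; lia.
Qed.

Lemma cyc_co_neq1 x : x != 0 -> cyc_co x != 1.
Proof.
apply: contra_neqN => /eqP c1; have := centered_dist x.
rewrite c1 subrr mulr0 pmulr_rle0 // => h; rewrite -[x]centered_intr.
suff -> : centered x = 0 by [].
apply/eqP; rewrite -absz_eq0 -(pnatr_eq0 R) -[_ == 0](@expf_eq0 _ _ 2).
by rewrite eq_le h sqr_ge0.
Qed.

(* Translation by [1] rotates the vector [(\sum co (r x), \sum si (r x))] by the
   non-trivial rotation [(co x, si x)]. *)
Lemma cyc_sum_co (x : 'Z_N) : \sum_r cyc_co (r * x) = #|'Z_N|%:R *+ (x == 0).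
Proof.
have [->|x0] := eqVneq x 0.
  under eq_bigr => r _ do rewrite mulr0.
  by rewrite sumr_const /cyc_co /zarg mulr0 mul0r cos0.
rewrite mulr0n; set C := \sum_r _; pose S := \sum_r cyc_si (r * x).
have eC : C = C * cyc_co x - S * cyc_si x.
  rewrite {1}/C (reindex_inj (addIr 1)) /= !mulr_suml -sumrB.
  by apply: eq_bigr => r _; rewrite mulrDl mul1r cyc_coD.
have eS : S = S * cyc_co x + C * cyc_si x.
  rewrite {1}/S (reindex_inj (addIr 1)) /= !mulr_suml -big_split /=.
  by apply: eq_bigr => r _; rewrite mulrDl mul1r cyc_siD.
have c2s2 : cyc_co x ^+ 2 + cyc_si x ^+ 2 = 1 := cos2Dsin2 _.
have c1 := cyc_co_neq1 x0.
have /eqP : C * (1 - cyc_co x) = 0.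
  move: (cyc_co x) (cyc_si x) eC eS c2s2; clear => c s eC eS c2s2.
  (* Eliminating [S] leaves [C * ((1 - c)^2 + s^2) = 0], that is [2 * C * (1 - c) = 0]. *)
  have h1 : C * (1 - c) = - S * s by lra.
  have h2 : S * (1 - c) = C * s by lra.
  have e1 : C * (1 - c) * (1 - c) = - S * s * (1 - c) by rewrite h1.
  have e2 : C * s * s = S * (1 - c) * s by rewrite h2.
  have e3 : C * (c ^+ 2 + s ^+ 2) = C by rewrite c2s2 mulr1.
  by move: e1 e2 e3; clear; lra.
by rewrite mulf_eq0 subr_eq0 [1 == _]eq_sym (negPf c1) orbF => /eqP.
Qed.

(** Closed by [Defined] so that [dist] unfolds to [1 - cyc_co] by conversion in the final proof. *)
Definition cyc_character : character R 'Z_N.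
Proof.
apply: (@Character R 'Z_N cyc_co cyc_si).
- by rewrite /cyc_co /zarg mulr0 mul0r cos0.
- by rewrite /cyc_si /zarg mulr0 mul0r sin0.
- exact: cyc_coD.
- exact: cyc_siD.
- exact: cyc_coN.
- exact: cyc_siN.
- by move=> x; apply: cos2Dsin2.
- exact: cyc_sum_co.
Defined.

Lemma intr_Zp_eq0 (z : int) : (z%:~R == 0 :> 'Z_N) = (N %| `|z|)%N.
Proof.
have natE n : (n%:R == 0 :> 'Z_N) = (N %| n)%N.
  by rewrite -val_eqE /= val_Zp_nat.
case: z => n; first exact: natE.
by rewrite NegzE rmorphN oppr_eq0 abszN natE.
Qed.

Lemma unit_Zp_prime (r : 'Z_N) : prime N -> r != 0 -> r \is a GRing.unit.
Proof.
move=> pN r0; rewrite -[r]natr_Zp unitZpE // prime_coprime // gtnNdvd //.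
by rewrite lt0n; apply: contra r0.
Qed.

(** Since [r] is invertible, the dilation and shift respect [k]-fold sums in both directions. Sums
    of [k] lifts are below [N / 2] in absolute value, so congruent ones are equal. *)
Lemma rectifiable_of_centered (k : nat) (A : {set 'Z_N}) (r a0 : 'Z_N) :
  prime N -> (0 < k)%N -> r != 0 ->
  (forall a, a \in A -> (2 * k * `|centered (r * (a - a0))%R| < N)%N) ->
  rectifiable k [set` A]%classic.
Proof.
move=> pN k0 r0 small; have ru := unit_Zp_prime pN r0.
pose f a := centered (r * (a - a0)).
have sumE (a : 'I_k -> 'Z_N) :
    (\sum_i f (a i))%:~R = r * (\sum_i a i) - r * a0 *+ k.
  rewrite rmorph_sum /= mulr_sumr.
  under eq_bigr => i _ do rewrite centered_intr mulrBr.
  by rewrite sumrB sumr_const card_ord.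
exists [set: int]%classic, f; split=> //.
  move=> a b _ _ /(congr1 (fun z : int => z%:~R : 'Z_N)).
  by rewrite !centered_intr => /(mulrI ru)/addIr.
move=> a b aA bA; split=> [eab|eab]; last first.
  by move: (congr1 (fun z : int => z%:~R : 'Z_N) eab); rewrite !sumE => /addIr/(mulrI ru).
have lt_half (c : 'I_k -> 'Z_N) : (forall i, c i \in A) ->
    (2 * `|(\sum_i f (c i))%R| < N)%N.
  move=> cA; rewrite -(ltn_pmul2l k0) mulnA [(k * 2)%N]mulnC.
  have le : (`|(\sum_i f (c i))%R| <= \sum_i `|f (c i)|)%N.
    elim/big_rec2: _ => // i y z _ yz.
    by move: (f (c i)) y z yz; clear; lia.
  apply: (@leq_ltn_trans (\sum_(i < k) 2 * k * `|f (c i)|)%N).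
    by rewrite -big_distrr leq_mul2l le orbT.
  (* Each term is at most [N - 1]; strictness is recovered from [k (N - 1) < k N], as [k] is
     positive. *)
  apply: (@leq_ltn_trans (\sum_(i < k) p.+1)%N).
    by apply: leq_sum => i _; rewrite -ltnS small.
  by rewrite sum_nat_const card_ord ltn_pmul2l.
have e : (N %| `|(\sum_i f (a i) - \sum_i f (b i))%R|)%N.
  by rewrite -intr_Zp_eq0 rmorphB /= !sumE eab subrr.
apply/eqP; rewrite -subr_eq0 -absz_eq0; move: e; apply: contraLR; rewrite -lt0n => d0.
rewrite gtnNdvd //; have := lt_half a aA; have := lt_half b bA.
move: (\sum_i f (a i)) (\sum_i f (b i)) d0 => u v; clear; lia.
Qed.

End CyclicCharacter.

(** * Choice of parameters and conclusion *)

(* With [b ~ M], [j ~ M^2] and [n = 6 (m + 1) b j], the power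
   [(1 - M^-2)^n <= 2^-(6 (m + 1) b) <= M^-(6 (m + 1))] beats [(3 n + 1)^m <= M^(5 m)]. *)
Lemma exists_iteration_count (R : realType) (alpha K M : R) (m : nat) :
  1 <= K -> 32 * K <= M -> m.+1%:R <= 2 * K ^+ 2 -> 0 <= alpha ->
  alpha * M ^+ (6 * m.+1) <= 1 ->
  exists n : nat, (3 * n).+1%:R ^+ m * K ^+ 2 * (alpha + (1 - M ^- 2) ^+ n) < 1.
Proof.
move=> K1 KM mK al0 alM.
have M32 : 32 <= M by lra.
have M0 : 0 < M by lra.
pose b := (Num.trunc M).+1; pose j := (Num.trunc (M ^+ 2)).+1.
have bM : M <= b%:R by apply/ltW/truncnS_gt.
have jM : M ^+ 2 <= j%:R by apply/ltW/truncnS_gt.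
have bM1 : b%:R <= M + 1 by rewrite -natr1 lerD2r truncn_le ltW.
have jM1 : j%:R <= M ^+ 2 + 1 by rewrite -natr1 lerD2r truncn_le sqr_ge0.
pose n := (j * (b * (6 * m.+1)))%N; exists n.
set e := M ^- 2.
have e0 : 0 < e by rewrite invr_gt0 exprn_gt0.
have e1 : e <= 1 by rewrite invf_le1 ?exprn_gt0 // expr_ge1 //; lra.
have pow0 i : 0 < M ^+ i by rewrite exprn_gt0.
have half : (1 - e) ^+ j <= 2^-1.
  (* Bernoulli with [j e >= 1]; it combines with [(1 - e) (1 + e) <= 1]. *)
  have bern : 2 <= (1 + e) ^+ j.
    have : 1 + e *+ j <= (1 + e) ^+ j.
      elim: (j) => [|i IHi]; first by rewrite mulr0n addr0 expr0.
      rewrite exprS mulrSr; have : 0 <= e *+ i by rewrite mulrn_wge0 // ltW.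
      by have := ler_wpM2l (ltW e0) IHi; nra.
    apply: le_trans; rewrite -mulr_natr; have := ler_wpM2l (ltW e0) jM.
    by rewrite mulVf ?gt_eqF //; lra.
  rewrite -[2^-1]mul1r ler_pdivlMr //.
  apply: (@le_trans _ _ ((1 - e) ^+ j * (1 + e) ^+ j)).
    by rewrite ler_wpM2l // exprn_ge0 // subr_ge0.
  rewrite -exprMn exprn_ile1 //; nra.
have pb : 2^-1 ^+ b <= M^-1.
  rewrite exprVn lef_pV2 ?posrE ?exprn_gt0 //; apply: le_trans bM _.
  by rewrite -natrX ler_nat ltnW // ltn_expl.
have small : (1 - e) ^+ n <= M ^- (6 * m.+1).
  have e10 : 0 <= 1 - e by rewrite subr_ge0.
  rewrite /n exprM exprM -exprVn; apply: lerXn2r.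
  - by rewrite nnegrE !exprn_ge0.
  - by rewrite nnegrE invr_ge0 ltW.
  apply: le_trans pb; apply: lerXn2r; last exact: half.
    by rewrite nnegrE exprn_ge0.
  by rewrite nnegrE invr_ge0.
have al : alpha <= M ^- (6 * m.+1) by rewrite -[M ^- _]mul1r ler_pdivlMr.
(* From [j b <= 4 M^3] and [6 (m + 1) <= 12 (M / 32)^2] comes [3 n <= 9/64 M^5]; the extra 1 is at
   most [M^5 / 32]. *)
have n5 : (3 * n).+1%:R <= M ^+ 5.
  rewrite -natr1 /n !natrM.
  have M2 := pow0 2%N; have M3 := pow0 3%N; have M5 := pow0 5%N.
  have h1 : j%:R * b%:R <= 4 * M ^+ 3.
    rewrite (_ : 4 * M ^+ 3 = (2 * M ^+ 2) * (2 * M)); last by ring.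
    apply: ler_pM => //.
      by apply: le_trans jM1 _; nra.
    by apply: le_trans bM1 _; lra.
  have h2 : 6 * m.+1%:R <= 12 * (M / 32) ^+ 2.
    have : K ^+ 2 <= (M / 32) ^+ 2 by apply: lerXn2r; rewrite ?nnegrE; lra.
    by lra.
  have h3 : j%:R * b%:R * (6 * m.+1%:R) <= 4 * M ^+ 3 * (12 * (M / 32) ^+ 2).
    by apply: ler_pM => //; rewrite ?mulr_ge0.
  have h4 : 1 <= M ^+ 5 / 2 ^+ 5 by rewrite -expr_div_n exprn_ege1 //; lra.
  rewrite (_ : 4 * M ^+ 3 * (12 * (M / 32) ^+ 2) = 3 / 64 * M ^+ 5) in h3; last by field.
  by rewrite !mulrA in h3 *; lra.
have nm : (3 * n).+1%:R ^+ m <= M ^+ (5 * m).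
  by rewrite exprM; apply: lerXn2r; rewrite ?nnegrE // ltW.
have K2 : 1 <= K ^+ 2 by rewrite exprn_ege1.
have KM2 : 2 * K ^+ 2 < M ^+ 2.
  have : (32 * K) ^+ 2 <= M ^+ 2 by apply: lerXn2r; rewrite ?nnegrE; lra.
  by rewrite exprMn; lra.
apply: (@le_lt_trans _ _ (M ^+ (5 * m) * K ^+ 2 * (2 * M ^- (6 * m.+1)))).
  apply: ler_pM.
  - by rewrite mulr_ge0 ?sqr_ge0 ?exprn_ge0.
  - by rewrite addr_ge0 ?exprn_ge0 ?subr_ge0.
  - by apply: ler_wpM2r; rewrite ?sqr_ge0.
  - by lra.
rewrite mulrA ltr_pdivrMr // mul1r.
(* The power [5 m] cancels [(3 n + 1)^m], the power 2 beats [2 K^2], and [m + 4] is slack. *)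
have -> : (6 * m.+1 = 5 * m + (m + 4) + 2)%N by clear; lia.
rewrite (exprD M _ 2) (exprD M (5 * m)) (exprD M m).
have Mm : 1 <= M ^+ m * M ^+ 4 by rewrite -exprD exprn_ege1 //; lra.
have := pow0 (5 * m)%N; move: (M ^+ (5 * m)) => P P0.
rewrite -[ltLHS]mulrA [K ^+ 2 * 2]mulrC -[ltRHS]mulrA ltr_pM2l //.
by apply: lt_le_trans KM2 _; rewrite ler_peMl // ltW.
Qed.

(** Minimality tested on [Z = A] gives [|Y + A| <= K |Y|], hence [|Y + A + A| <= K^2 |Y|]; the
    covering bound doubles this. *)
Lemma exists_doubling_cover (R : realType) (G : finZmodType) (K : R) (A : {set G}) :
  A != set0 -> #|sumset A A|%:R = K * #|A|%:R ->
  exists X Y : {set G}, [/\ X != set0, Y != set0, Y \subset A,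
    covering A Y X & #|X|.+1%:R <= 2 * K ^+ 2].
Proof.
move=> A0 cardAA; have [Y [YA Y0 Ymin]] := exists_min_expanding A0.
have [X [_ X0 cov cardX]] := exists_covering A0 YA Y0.
exists X, Y; split=> //.
have a0 : 0 < #|A|%:R :> R by rewrite ltr0n card_gt0.
have y0 : 0 < #|Y|%:R :> R by rewrite ltr0n card_gt0.
have h1 : #|sumset Y A|%:R <= K * #|Y|%:R.
  rewrite -(ler_pM2r a0) mulrAC -cardAA -!natrM ler_nat.
  exact: (Ymin A).
have h2 : #|sumset (sumset Y A) A|%:R * #|Y|%:R <= (K * #|Y|%:R) ^+ 2.
  apply: (@le_trans _ _ (#|sumset Y A|%:R ^+ 2)).
    by rewrite -natrM -natrX ler_nat min_expanding_double.
  by apply: lerXn2r; rewrite ?nnegrE ?ler0n // (le_trans _ h1).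
have h3 : #|X|.+1%:R * #|Y|%:R <= 2 * #|sumset (sumset Y A) A|%:R :> R.
  by rewrite -!natrM ler_nat.
rewrite -(ler_pM2r (exprn_gt0 2 y0)).
have := ler_wpM2r (ltW y0) h3; have := h2; lra.
Qed.

Lemma card_iter_sumset_doubling (R : realType) (G : finZmodType) (K : R)
    (A X Y : {set G}) n :
  Y \subset A -> Y != set0 -> covering A Y X -> A != set0 ->
  #|sumset A A|%:R = K * #|A|%:R ->
  #|iter_sumset A (sumset X Y) n|%:R <= (3 * n).+1%:R ^+ #|X| * K ^+ 2 * #|A|%:R :> R.
Proof.
move=> YA Y0 cov A0 cardAA.
have a0 : 0 < #|A|%:R :> R by rewrite ltr0n card_gt0.
apply: (@le_trans _ _ ((3 * n).+1%:R ^+ #|X| * #|diffset A A|%:R)).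
  by rewrite -natrX -natrM ler_nat card_iter_sumset.
rewrite -mulrA ler_wpM2l ?exprn_ge0 // -(ler_pM2r a0).
have := card_diffset A; rewrite -(ler_nat R) natrM natrX cardAA exprMn.
by lra.
Qed.

Local Open Scope classical_set_scope.
Unset Implicit Arguments.
Set Strict Implicit.

Theorem theorem2 (R : realType) (N : nat) (alpha K : R) (k : nat)
    (A : {set 'Z_N}) :
  prime N ->
  0 < alpha -> alpha < 1 ->
  1 <= K ->
  (2 <= k)%N ->
  #|A|%:R = alpha * N%:R ->
  #|sumset A A|%:R = K * #|A|%:R ->
  alpha <= (16 * k%:R * K) `^ (- (12 * K ^+ 2)) ->
  rectifiable k [set` A].
Proof.
case: N A => [|[|p]] // A pN al0 _ K1 k2 cardA cardAA alK.
pose N := p.+2; rewrite -/N in pN cardA.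
have N0 : 0 < N%:R :> R by rewrite ltr0n.
have A0 : A != set0.
  by rewrite -card_gt0 -(ltr_nat R) cardA mulr_gt0.
have a0 : 0 < #|A|%:R :> R by rewrite ltr0n card_gt0.
have [X [Y [X0 Y0 YA cov cardX]]] := exists_doubling_cover A0 cardAA.
set m := #|X| in cardX.
set M := 16 * k%:R * K in alK.
have k2R : 2 <= k%:R :> R by rewrite ler_nat.
have KM : 32 * K <= M.
  by rewrite /M ler_wpM2r; lra.
have M0 : 0 < M by lra.
(* The exponent in the hypothesis enters through [6 (m + 1) <= 12 K^2]. *)
have alM : alpha * M ^+ (6 * m.+1) <= 1.
  rewrite -ler_pdivlMr ?exprn_gt0 // div1r; apply: le_trans alK _.
  rewrite powRN lef_pV2 ?posrE ?exprn_gt0 ?powR_gt0 // -[M ^+ _]powR_mulrn ?(ltW M0) //.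
  by apply: ler_powR; rewrite ?natrM; lra.
have [n small] := exists_iteration_count K1 KM cardX (ltW al0) alM.
pose chi := cyc_character R p; pose eps := M ^- 2.
have eps0 : 0 < eps by rewrite invr_gt0 exprn_gt0.
have eps1 : eps <= 1 by rewrite invf_le1 ?exprn_gt0 // expr_ge1 //; lra.
have [r r0 large] : exists2 r : 'Z_N, r != 0 &
    (1 - eps) * (#|X|%:R * #|Y|%:R) ^+ 2 <
      energy chi (ind R X) r * energy chi (ind R Y) r.
  (* Otherwise [N |A|] is at most [|S| (|A| + (1 - eps)^n N)] for the iterated sumset [S]; the
     polynomial bound on [|S|] and the choice of [n] make this less than [N |A|]. *)
  apply: contrapT => none.
  have := @small_energy_growth R 'Z_N chi A X Y n eps A0 X0 Y0 eps1.
  rewrite card_ord => growth.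
  have {growth} : N%:R * #|A|%:R <= #|iter_sumset A (sumset X Y) n|%:R *
      (#|A|%:R + (1 - eps) ^+ n * N%:R).
    apply: growth => r r0; rewrite leNgt; apply/negP => lt; apply: none.
    by exists r.
  apply/negP; rewrite -ltNge.
  have := @card_iter_sumset_doubling R _ K A X Y n YA Y0 cov A0 cardAA.
  have q0 : 0 < alpha * N%:R + (1 - eps) ^+ n * N%:R.
    by rewrite ltr_pwDl ?mulr_gt0 ?mulr_ge0 ?exprn_ge0 ?subr_ge0 // ltW.
  rewrite -(ler_pM2r q0) -cardA => /le_lt_trans; apply.
  have h := small; rewrite -/eps -/m -(ltr_pM2r (mulr_gt0 N0 a0)) mul1r in h.
  apply: le_lt_trans h; rewrite -/m cardA le_eqVlt; apply/orP; left; apply/eqP; ring.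
have [a0' a0A] := set0Pn _ A0.
apply: (@rectifiable_of_centered p k A r a0') => // [|a aA]; first exact: ltnW.
have lift := @centered_dist R p (r * (a - a0')).
have close := large_energy_dist X0 Y0 cov eps0 eps1 large aA a0A.
rewrite -/m -[dist _ _]/(1 - cyc_co R (r * (a - a0'))) in close.
(* As [72 (m + 1) eps <= 144 K^2 eps], this gives [4 (k w)^2 <= 144/256 N^2], so
   [2 k w <= 3/4 N < N]. *)
have Meps : 256 * (k%:R ^+ 2 * K ^+ 2 * eps) = 1.
  rewrite /eps (_ : M ^+ 2 = 256 * (k%:R ^+ 2 * K ^+ 2)); last by rewrite /M; ring.
  have k0 : 0 < k%:R :> R by lra.
  have K0 : 0 < K by lra.
  have kK0 : 0 < k%:R ^+ 2 * K ^+ 2 by rewrite mulr_gt0 ?exprn_gt0.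
  by rewrite mulrA; apply: divff; apply: lt0r_neq0; rewrite mulr_gt0 ?ltr0n.
set w := `|_|%N in lift *.
have wN : w%:R ^+ 2 * 4 <= N%:R ^+ 2 * (144 * K ^+ 2 * eps).
  rewrite mulrC; apply: le_trans lift _; rewrite ler_wpM2l ?sqr_ge0 //.
  by apply: le_trans close _; apply: ler_wpM2r; [exact: ltW|lra].
rewrite -(ltr_nat R) -(@ltr_pXn2r _ 2) ?nnegrE ?ler0n // !natrM.
have := ler_wpM2r (sqr_ge0 (k%:R : R)) wN.
have -> : N%:R ^+ 2 * (144 * K ^+ 2 * eps) * k%:R ^+ 2 =
    N%:R ^+ 2 * (9 / 16) * (256 * (k%:R ^+ 2 * K ^+ 2 * eps)) by field.
rewrite Meps mulr1 => wk.
have : 0 < N%:R ^+ 2 :> R by rewrite exprn_gt0.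
rewrite -/N !exprMn; lra.
Qed.
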